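(* Let $n,d,u\ge 0$ be integers with $d+u+1\le n$. Consider repositories with $n$ packages, no conflicts ($C=\emptyset$), at most $d$ defects ($|D|\le d$) and at most $u$ unknown dependencies ($|U|\le u$). There exists a non-adaptive algorithm that solves Maximal Sub-repository on all such repositories using $\mathcal S_{n,d,u+1}$ queries.
   Context: A repository consists of a finite set $P$ of $n$ packages, a set $K\subseteq P\times P$ of known dependencies, a set $U\subseteq P\times P$ of unknown dependencies, a set $C$ of unknown conflicts (unordered pairs of distinct packages), and a set $D\subseteq P$ of defects. A dependency $(q,p)\in K\cup U$ means that $q$ depends on $p$. The digraph $(P,K)$ is acyclic. An installation is a subset $I\subseteq P$; it is successful iff (i) $I\cap D=\emptyset$, (ii) for every $(q,p)\in K\cup U$, $q\in I$ implies $p\in I$, and (iii) no $\{p,q\}\in C$ satisfies $p,q\in I$. A defect is a package contained in no successful installation, and $D$ is the set of all defects (so every package outside $D$ lies in some successful installation; in particular a package that depends on a defect is a defect). An algorithm is given $P$, $K$ and the bounds $d,u$. A query is an installation $I\subseteq P$; the oracle answers whether $I$ is successful. A non-adaptive algorithm fixes its whole set of queries from its input alone, then computes its output from the answers. Local computation is free; the cost is the number of queries. ''Using $q$ queries'' means at most $q$ queries on every input. Maximal Sub-repository: find a maximum-size set of packages $P_{max}\subseteq P$ that is a successful installation. For $a,b\ge 0$ with $a+b\le n$, an $(n,a,b)$-cover-free family (CFF) is a set $\mathcal F\subseteq\{0,1\}^n$ such that for all disjoint $S_1,S_2\subseteq\{1,\dots,n\}$ with $|S_1|=a$, $|S_2|=b$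 there is $v\in\mathcal F$ with $v_i=0$ for all $i\in S_1$ and $v_i=1$ for all $i\in S_2$. $\mathcal S_{n,a,b}$ denotes the minimal size of an $(n,a,b)$-CFF. *)

(* Defs.v *)
From mathcomp Require Import all_boot.
Set Implicit Arguments.
Unset Strict Implicit.
Unset Printing Implicit Defensive.

(* A pair (q, p) in [known] or [unknown] means that q depends on p.
   An unordered pair of packages is a two-element set. *)
Record repository (P : finType) := Repository {
  known : {set P * P};
  unknown : {set P * P};
  conflicts : {set {set P}};
  defects : {set P}
}.

(* [cycle] ranges over closed walks, so loops are excluded as well. *)
Definition acyclic (P : finType) (K : {set P * P}) : Prop :=
  forall c : seq P, cycle (fun q p => (q, p) \in K) c -> c = [::].

Definition successful (P : finType) (r : repository P) (I : {set P}) : bool :=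
  [&& [disjoint I & defects r],
      [forall e in known r :|: unknown r, (e.1 \in I) ==> (e.2 \in I)]
    & [forall c in conflicts r, ~~ (c \subset I)]].

Definition defect (P : finType) (r : repository P) (p : P) : bool :=
  ~~ [exists I : {set P}, successful r I && (p \in I)].

(* [successful] refers to the declared set [defects r]; the last clause
   requires that set to consist of exactly the packages that lie in no
   successful installation. *)
Definition wf_repository (P : finType) (r : repository P) : Prop :=
  [/\ acyclic (known r),
      forall c, c \in conflicts r -> #|c| = 2
    & defects r = [set p | defect r p]].

Definition max_subrepository (P : finType) (r : repository P) (M : {set P}) :
    Prop :=
  successful r M /\ forall I : {set P}, successful r I -> #|I| <= #|M|.

(* The inputs are P, the known dependencies and the bounds d, u.  The last
   argument of [output] encodes the answers, as the set of those queries that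
   were answered positively. *)
Record nonadaptive_algorithm := NonadaptiveAlgorithm {
  queries : forall P : finType, {set P * P} -> nat -> nat -> {set {set P}};
  output : forall P : finType,
    {set P * P} -> nat -> nat -> {set {set P}} -> {set P}
}.

Definition run (A : nonadaptive_algorithm) (P : finType) (r : repository P)
    (d u : nat) : {set P} :=
  output A (known r) d u
    [set I in queries A (known r) d u | successful r I].

Definition cover_free (n a b : nat) (F : {set n.-tuple bool}) : bool :=
  [forall S1 : {set 'I_n}, forall S2 : {set 'I_n},
    [&& [disjoint S1 & S2], #|S1| == a & #|S2| == b] ==>
    [exists v in F,
      [forall i in S1, tnth v i == false] &&
      [forall i in S2, tnth v i == true]]].

Definition cff_size (n a b : nat) : nat :=
  #|[arg min_(F < [set: n.-tuple bool] | cover_free a b F) #|F|]|.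

(* The starting point of the [arg min] above is admissible, so [cff_size] is
   a genuine minimum. *)
Lemma cover_free_setT (n a b : nat) : cover_free a b [set: n.-tuple bool].
Proof.
apply/forallP=> S1; apply/forallP=> S2; apply/implyP=> /and3P[dS _ _].
apply/existsP; exists [tuple i \in S2 | i < n]; rewrite inE /=.
apply/andP; split; apply/forallP=> i; apply/implyP=> Si;
  rewrite tnth_mktuple ?Si //.
by rewrite (disjointFr dS Si).
Qed.

Lemma cff_sizeP (n a b : nat) :
  (exists2 F : {set n.-tuple bool}, cover_free a b F & #|F| = cff_size n a b)
  /\ (forall F : {set n.-tuple bool}, cover_free a b F ->
        cff_size n a b <= #|F|).
Proof.
rewrite /cff_size; case: arg_minnP => [|F cfF minF].
  exact: cover_free_setT.
by split; [exists F | exact: minF].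
Qed.

(* Main.v *)
(** With no conflicts, successful installations are closed under union, so the
    complement of the defects is the maximum one.  The queries are the upward
    closures, under the known dependencies, of the members of a minimal
    cover-free family; the output is the union of the successful queries.
    Given a non-defect p, some member avoids all defects and contains p and
    every non-defect target of an unknown dependency.  Its closure contains no
    defect, since a package that depends on a defect is a defect; so every
    unknown dependency leaving it has a non-defect target, which it contains.
    Hence that query is successful and contains p. *)
Require Import Defs.
From mathcomp Require Import all_boot.

Lemma exists_set_between (T : finType) (A C : {set T}) (k : nat) :
  A \subset C -> #|A| <= k <= #|C| ->
  exists B : {set T}, [/\ A \subset B, B \subset C & #|B| = k].
Proof.
move=> sAC; elim: k => [|k IHk] /andP[leAk lekC].
  by exists A; split=> //; apply/eqP; rewrite -leqn0.
(* When [A] already has [k.+1] elements the induction hypothesis is out of reach; otherwise one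
   element of [C] is added to a set of size [k]. *)
have [eqAk|neqAk] := eqVneq #|A| k.+1; first by exists A.
have ltAk : #|A| <= k by rewrite -ltnS ltn_neqAle neqAk.
have [|B [sAB sBC cardB]] := IHk; first by rewrite ltAk ltnW.
have /properP[_ [x Cx nBx]] : B \proper C by rewrite properEcard sBC cardB.
exists (x |: B); split; last by rewrite cardsU1 nBx cardB.
  exact: subset_trans sAB (subsetUr _ _).
by rewrite subUset sub1set Cx.
Qed.

(** Cover-freeness speaks of sets of exact sizes, whereas only upper bounds are known here. [A] is
    padded outside [B] first, then [B] outside the padded [A']. *)
Lemma exists_disjoint_supersets {T : finType} {A B : {set T}} (a b : nat) :
  [disjoint A & B] -> #|A| <= a -> #|B| <= b -> a + b <= #|T| ->
  exists A' B' : {set T},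
    [/\ A \subset A', B \subset B', [disjoint A' & B'], #|A'| = a & #|B'| = b].
Proof.
move=> dAB leAa leBb leabT.
have [||A' [sAA' sA'B cardA']] := @exists_set_between T A (~: B) a.
- by rewrite -disjoints_subset.
- by rewrite leAa cardsCs setCK leq_subRL ?max_card // (leq_trans _ leabT) //
    addnC leq_add2l.
have [||B' [sBB' sB'A' cardB']] := @exists_set_between T B (~: A') b.
- by rewrite -disjoints_subset disjoint_sym disjoints_subset.
- by rewrite leBb cardsCs setCK cardA' leq_subRL // (leq_trans _ leabT) // leq_addr.
by exists A', B'; split=> //; rewrite disjoint_sym disjoints_subset.
Qed.

(** Coordinates are matched with packages by [enum_rank]. A plain sequence avoids a cast between [n]
    and [#|P|]; the default [false] is never reached when [v] has length [#|P|]. *)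
Definition selected (P : finType) (v : seq bool) : {set P} :=
  [set x : P | nth false v (enum_rank x)].

Lemma cover_free_selected {n a b : nat} {F : {set n.-tuple bool}}
    {P : finType} {A B : {set P}} :
  #|P| = n -> cover_free a b F -> a + b <= n ->
  [disjoint A & B] -> #|A| <= a -> #|B| <= b ->
  exists2 v, v \in F & [disjoint A & selected P v] /\ B \subset selected P v.
Proof.
move=> cardP; case: n / cardP F => F cfF leabP dAB leAa leBb.
have [A' [B' [sAA' sBB' dA'B' cardA' cardB']]] :=
  exists_disjoint_supersets a b dAB leAa leBb leabP.
have rank_inj := @enum_rank_inj P.
have dAB' : [disjoint enum_rank @: A' & enum_rank @: B'].
  rewrite -setI_eq0 -imsetI; last by move=> x y _ _; apply: rank_inj.
  by move: dA'B'; rewrite -setI_eq0 => /eqP->; rewrite imset0.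
move/forallP/(_ (enum_rank @: A'))/forallP/(_ (enum_rank @: B')): cfF.
rewrite !card_imset // cardA' cardB' !eqxx dAB' => /exists_inP[v Fv].
case/andP=> /forall_inP v0 /forall_inP v1; exists v => //.
split.
  rewrite disjoints_subset; apply/subsetP=> x /(subsetP sAA') A'x.
  by rewrite !inE -tnth_nth (eqP (v0 _ (imset_f _ A'x))).
apply/subsetP=> x /(subsetP sBB') B'x.
by rewrite inE -tnth_nth (eqP (v1 _ (imset_f _ B'x))).
Qed.

Definition dep_closure (P : finType) (K : {set P * P}) (S : {set P}) : {set P} :=
  [set y | [exists x in S, connect (fun q p => (q, p) \in K) x y]].

Lemma sub_dep_closure (P : finType) (K : {set P * P}) (S : {set P}) :
  S \subset dep_closure P K S.
Proof.
by apply/subsetP=> x Sx; rewrite inE; apply/exists_inP; exists x.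
Qed.

Lemma dep_closure_closed {P : finType} {K : {set P * P}} {S : {set P}} {q p : P} :
  (q, p) \in K -> q \in dep_closure P K S -> p \in dep_closure P K S.
Proof.
move=> Kqp; rewrite !inE => /exists_inP[x Sx xq]; apply/exists_inP.
by exists x => //; apply: connect_trans xq (connect1 _).
Qed.

Lemma dep_closure_min {P : finType} {K : {set P * P}} {S T : {set P}} :
  S \subset T -> (forall q p, (q, p) \in K -> q \in T -> p \in T) ->
  dep_closure P K S \subset T.
Proof.
move=> /subsetP sST closedT; apply/subsetP=> y.
rewrite inE => /exists_inP[x /sST Tx /connectP[s]].
elim: s x Tx => [|z s IHs] x Tx /=; first by move=> _ ->.
by case/andP=> Kxz; apply: IHs; apply: closedT Kxz Tx.
Qed.

Section ConflictFree.

Context {P : finType} {r : repository P}.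
Hypothesis no_conflicts : conflicts r = set0.

Lemma successfulP (I : {set P}) :
  reflect ([disjoint I & defects r] /\
           forall q p, (q, p) \in known r :|: unknown r -> q \in I -> p \in I)
          (successful r I).
Proof.
rewrite /successful no_conflicts.
apply: (iffP and3P) => [[dI /forall_inP depI _] | [dI depI]].
  by split=> // q p /depI/implyP.
split=> //; last by apply/forall_inP=> c; rewrite inE.
by apply/forall_inP=> -[q p] /depI qp; apply/implyP.
Qed.

Lemma successful_cover (Q : {set {set P}}) :
  (forall I, I \in Q -> successful r I) -> successful r (cover Q).
Proof.
move=> sucQ; apply/successfulP; split=> [|q p dep_qp].
  rewrite disjoints_subset; apply/bigcupsP=> I /sucQ/successfulP[].
  by rewrite disjoints_subset.
case/bigcupP=> I QI Iq; apply/bigcupP; exists I => //.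
by have /successfulP[_ /(_ q p dep_qp)] := sucQ I QI; apply.
Qed.

(** A successful installation containing [q] also contains [p], so it witnesses that [p] is no
    defect. *)
Lemma nondefects_closed : wf_repository r ->
  forall q p, (q, p) \in known r :|: unknown r ->
  q \in ~: defects r -> p \in ~: defects r.
Proof.
move=> [_ _ ->] q p dep_qp; rewrite !inE !negbK.
case/existsP=> I /andP[sucI Iq]; apply/existsP; exists I.
by have /successfulP[_ /(_ q p dep_qp Iq) ->] := sucI; rewrite sucI.
Qed.

Lemma dep_closure_successful (S : {set P}) :
  wf_repository r -> [disjoint defects r & S] ->
  [set e.2 | e in unknown r] :\: defects r \subset S ->
  successful r (dep_closure P (known r) S).
Proof.
move=> wf_r dDS /subsetP sUS; have closedD := nondefects_closed wf_r.
have sI : dep_closure P (known r) S \subset ~: defects r.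
  apply: dep_closure_min => [|q p Kqp].
    by rewrite -disjoints_subset disjoint_sym.
  by apply: closedD; rewrite inE Kqp.
apply/successfulP; split=> [|q p]; first by rewrite disjoints_subset.
case/setUP=> [Kqp|Uqp Iq]; first exact: dep_closure_closed Kqp.
apply/(subsetP (sub_dep_closure _ _ _))/sUS.
rewrite in_setD -in_setC (closedD q p) ?(subsetP sI) //; last first.
  by rewrite inE Uqp orbT.
by apply/imsetP; exists (q, p).
Qed.

End ConflictFree.

(** The bounds enter only through the choice of [F], made before [P] and [K] are given. *)
Definition cff_algorithm (n : nat) (F : {set n.-tuple bool}) :
    nonadaptive_algorithm :=
  @NonadaptiveAlgorithm
    (fun P K _ _ => [set dep_closure P K (selected P v) | v : n.-tuple bool in F])
    (fun P _ _ _ answers => cover answers).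

Theorem theorem5 (n d u : nat) (hn : d + u + 1 <= n) :
  exists A : nonadaptive_algorithm,
    forall P : finType, #|P| = n ->
      (forall K : {set P * P}, acyclic K ->
         #|queries A K d u| <= cff_size n d (u + 1)) /\
      (forall r : repository P,
         wf_repository r ->
         conflicts r = set0 ->
         #|defects r| <= d ->
         #|unknown r| <= u ->
         max_subrepository r (run A r d u)).
Proof.
have [[F cfF cardF] _] := cff_sizeP n d (u + 1).
exists (cff_algorithm n F) => P cardP; split=> [K _|r wf_r noC leDd leUu].
  (* Different vectors may have the same closure, hence only an inequality. *)
  by rewrite -cardF leq_imset_card.
split=> [|I /(successfulP noC)[dID _]].
  by apply: (successful_cover noC) => I; rewrite inE => /andP[].
(* Maximality follows from inclusion: the output contains every successful [I]. *)
apply/subset_leq_card/subsetP=> p Ip.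
have nDp : p \notin defects r by rewrite (disjointFr dID Ip).
(* The parameter [u + 1] arises here: at most [u] targets, plus [p] itself. *)
pose B := p |: ([set e.2 | e in unknown r] :\: defects r).
have dDB : [disjoint defects r & B].
  rewrite disjoint_sym disjoints_subset subUset sub1set inE nDp.
  by rewrite setDE subsetIr.
have leBu : #|B| <= u + 1.
  rewrite cardsU1 addnC leq_add ?leq_b1 //.
  apply: leq_trans (subset_leq_card (subsetDl _ _)) _.
  exact: leq_trans (leq_imset_card _ _) leUu.
have [|v Fv [dDv]] := cover_free_selected cardP cfF _ dDB leDd leBu.
  by rewrite addnA.
rewrite subUset sub1set => /andP[vp sUv].
apply/bigcupP; exists (dep_closure P (known r) (selected P v)).
  rewrite in_set (dep_closure_successful noC) // andbT.
  by apply/imsetP; exists v.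
exact: (subsetP (sub_dep_closure _ _ _)).
Qed.
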